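(* Let $T$ be a minimal rotation on a locally connected compact metrizable group $X$ and let $f\colon X\to G$ be a continuous topologically recurrent cocycle with values in a nilpotent locally compact second countable group $G$. Then $f$ is regular.
   Context: The cocycle is $f(n,x)=f(T^{n-1}x)\cdots f(x)$ for $n\ge1$, $f(0,x)=\mathbf 1_G$, $f(n,x)=f(-n,T^nx)^{-1}$ for $n<0$. $f$ is topologically recurrent if for every open neighbourhood $U$ of $\mathbf 1_G$ and nonempty open $\mathcal O\subseteq X$ there is $n\neq0$ with $T^{-n}\mathcal O\cap\mathcal O\cap\{y:f(n,y)\in U\}\neq\varnothing$. The skew product is $\mathbf T_f(x,g)=(Tx,f(x)g)$ on $X\times G$; $f$ is regular if some point of $X\times G$ has a $\mathbf T_f$-orbit closure that projects onto all of $X$ under the first coordinate projection. *)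

(* Defs.v *)
From HB Require Import structures.
From mathcomp Require Import all_boot all_order all_algebra.
From mathcomp Require Import all_classical all_reals all_analysis.
From mathcomp Require Import Rstruct Rstruct_topology.
From Stdlib Require Import Reals.
Set Implicit Arguments. Unset Strict Implicit. Unset Printing Implicit Defensive.
Import Order.TTheory GRing.Theory Num.Theory.
Local Open Scope classical_set_scope.

Definition is_group (G : Type) (mul : G -> G -> G) (inv : G -> G) (one : G) :=
  [/\ forall x y z, mul x (mul y z) = mul (mul x y) z,
      forall x, mul one x = x, forall x, mul x one = x,
      forall x, mul (inv x) x = one & forall x, mul x (inv x) = one].

Definition topological_group (G : topologicalType)
  (mul : G -> G -> G) (inv : G -> G) (one : G) :=
  [/\ is_group mul inv one,
      continuous (fun p : G * G => mul p.1 p.2) & continuous inv].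

Definition is_subgroup (G : Type) (mul : G -> G -> G) (inv : G -> G) (one : G)
  (H : set G) := [/\ H one, forall x y, H x -> H y -> H (mul x y)
                    & forall x, H x -> H (inv x)].

Definition gen_subgroup (G : Type) (mul : G -> G -> G) (inv : G -> G) (one : G)
  (S : set G) : set G :=
  [set g | forall H, is_subgroup mul inv one H -> S `<=` H -> H g].

Definition commutator (G : Type) (mul : G -> G -> G) (inv : G -> G) (x y : G) :=
  mul (mul (inv x) (inv y)) (mul x y).

(* lower_central k = gamma_{k+1}(G): gamma_1 = G, gamma_{k+1} = [G, gamma_k] *)
Fixpoint lower_central (G : Type) (mul : G -> G -> G) (inv : G -> G) (one : G)
  (k : nat) : set G :=
  match k with
  | 0 => setT
  | k'.+1 => gen_subgroup mul inv one
      [set g | exists x y, lower_central mul inv one k' y /\ g = commutator mul inv x y]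
  end.

Definition nilpotent_group (G : Type) (mul : G -> G -> G) (inv : G -> G) (one : G) :=
  exists k, lower_central mul inv one k = [set one].

Definition metrizable (X : topologicalType) :=
  exists d : X -> X -> R,
    [/\ forall x y, (0 <= d x y)%R,
        forall x y, d x y = 0%R <-> x = y,
        forall x y, d x y = d y x,
        forall x y z, (d x z <= d x y + d y z)%R &
        forall x, nbhs x = filter_from [set e : R | (0 < e)%R]
                                       (fun e => [set y | (d x y < e)%R])].

Definition locally_connected (X : topologicalType) :=
  forall (x : X) (U : set X), nbhs x U ->
    exists V : set X, [/\ open V, V x, connected V & V `<=` U].

Definition iter_z (X : Type) (T Tinv : X -> X) (n : int) : X -> X :=
  match n with
  | Posz k => iter k T
  | Negz k => iter k.+1 Tinv
  end.

Definition orbit_z (X : Type) (T Tinv : X -> X) (x : X) : set X :=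
  [set iter_z T Tinv n x | n in [set: int]].

Definition minimal_homeo (X : topologicalType) (T Tinv : X -> X) :=
  forall x : X, closure (orbit_z T Tinv x) = [set: X].

Fixpoint cocycle_nat (X G : Type) (mulG : G -> G -> G) (oneG : G)
  (T : X -> X) (f : X -> G) (n : nat) (x : X) : G :=
  match n with
  | 0 => oneG
  | k.+1 => mulG (f (iter k T x)) (cocycle_nat mulG oneG T f k x)
  end.

Definition cocycle (X G : Type) (mulG : G -> G -> G) (invG : G -> G) (oneG : G)
  (T Tinv : X -> X) (f : X -> G) (n : int) (x : X) : G :=
  match n with
  | Posz k => cocycle_nat mulG oneG T f k x
  | Negz k => invG (cocycle_nat mulG oneG T f k.+1 (iter_z T Tinv (Negz k) x))
  end.

Definition top_recurrent (X G : topologicalType)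
  (mulG : G -> G -> G) (invG : G -> G) (oneG : G)
  (T Tinv : X -> X) (f : X -> G) :=
  forall (U : set G) (O : set X), open U -> U oneG -> open O -> O !=set0 ->
    exists n : int, n != Posz 0 /\
      exists y, [/\ O (iter_z T Tinv n y), O y &
                    U (cocycle mulG invG oneG T Tinv f n y)].

Definition skew (X G : Type) (mulG : G -> G -> G) (T : X -> X) (f : X -> G)
  (p : X * G) : X * G := (T p.1, mulG (f p.1) p.2).

Definition skew_inv (X G : Type) (mulG : G -> G -> G) (invG : G -> G)
  (Tinv : X -> X) (f : X -> G) (p : X * G) : X * G :=
  (Tinv p.1, mulG (invG (f (Tinv p.1))) p.2).

Definition regular_cocycle (X G : topologicalType)
  (mulG : G -> G -> G) (invG : G -> G) (T Tinv : X -> X) (f : X -> G) :=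
  exists p : X * G,
    fst @` closure (orbit_z (skew mulG T f) (skew_inv mulG invG Tinv f) p)
      = [set: X].

(* Main.v *)
Require Import Defs.
From HB Require Import structures.
From mathcomp Require Import all_boot all_order all_algebra.
From mathcomp Require Import all_classical all_reals all_analysis.
From mathcomp Require Import Rstruct zify lra.
Import Order.TTheory GRing.Theory Num.Theory.
Local Open Scope classical_set_scope.

(* Every stage of an induction on the lower central series provides a closed
   subgroup [H] and a closed [H]-principal subbundle [W] of [X * G], invariant
   under the skew product [S], in which some [w] has a dense orbit modulo
   [gamma_k].  Let [E] be the set of those [c] in [H] for which [w c] is a
   prolongational limit of [w] modulo [gamma_(k+1)].  As [gamma_k] is central
   modulo [gamma_(k+1)], density of the orbit of [w] transports this relation to
   all of [W], so [E] is a normal subgroup of [H].  By compactness, a short return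
   of the base point never lands in a compact shell around [w E] in [W / E], and
   local connectedness of [X] makes the side of the shell on which it lands
   independent of the starting point near [w].  Hence the times of short returns
   to the inner side are closed under addition as long as the rotation stays near
   the identity: they define a locally precompact group topology on the integers,
   which recurrence makes nondiscrete.  A locally compact monothetic group is
   discrete or compact, so these times are syndetic and the orbit closure of [w]
   in [W / E] is compact and minimal.  It is an [E]-principal bundle over [X], in
   which, by Baire, some point has a dense orbit modulo [gamma_(k+1)].  When
   [gamma_k] is trivial, this orbit closure projects onto [X]. *)

Set Implicit Arguments.
Unset Strict Implicit.
Unset Printing Implicit Defensive.

(** * Topological groups *)

Section TopologicalGroup.
Context (G : topologicalType) (mul : G -> G -> G) (inv : G -> G) (one : G).
Hypothesis topG : topological_group mul inv one.
Local Notation "x ⋆ y" := (mul x y) (at level 40, left associativity).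

Lemma tg_mulA x y z : x ⋆ y ⋆ z = x ⋆ (y ⋆ z). Proof. by case: topG => -[]. Qed.
Lemma tg_mul1 x : one ⋆ x = x. Proof. by case: topG => -[]. Qed.
Lemma tg_mulr1 x : x ⋆ one = x. Proof. by case: topG => -[]. Qed.
Lemma tg_mulV x : inv x ⋆ x = one. Proof. by case: topG => -[]. Qed.
Lemma tg_mulrV x : x ⋆ inv x = one. Proof. by case: topG => -[]. Qed.
Lemma tg_mulK x y : inv x ⋆ (x ⋆ y) = y.
Proof. by rewrite -tg_mulA tg_mulV tg_mul1. Qed.
Lemma tg_mulVK x y : x ⋆ (inv x ⋆ y) = y.
Proof. by rewrite -tg_mulA tg_mulrV tg_mul1. Qed.
Lemma tg_inv_eq x y : x ⋆ y = one -> y = inv x.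
Proof. by move=> xy; rewrite -(tg_mulK x y) xy tg_mulr1. Qed.
Lemma tg_invK x : inv (inv x) = x.
Proof. by rewrite [RHS](@tg_inv_eq (inv x)) // tg_mulV. Qed.
Lemma tg_invM x y : inv (x ⋆ y) = inv y ⋆ inv x.
Proof. by rewrite [RHS](@tg_inv_eq (x ⋆ y)) // tg_mulA tg_mulVK tg_mulrV. Qed.
Lemma tg_inv1 : inv one = one.
Proof. by rewrite [RHS](@tg_inv_eq one) // tg_mul1. Qed.

(* A rewriting system deciding equality of words in the free group. *)
Definition tgE := (tg_mulA, tg_invM, tg_invK, tg_inv1, tg_mul1, tg_mulr1,
                   tg_mulV, tg_mulrV, tg_mulK, tg_mulVK).

Lemma tg_mul_cont (p : G * G) : (fun q : G * G => q.1 ⋆ q.2) @ p --> p.1 ⋆ p.2.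
Proof. by case: topG => _ + _; apply. Qed.
Lemma tg_inv_cont x : inv @ x --> inv x.
Proof. by case: topG => _ _; apply. Qed.
Arguments tg_mul_cont : clear implicits.
Arguments tg_inv_cont : clear implicits.
Lemma tg_mul_cvg (I : Type) (F : set_system I) (u v : I -> G) x y : Filter F ->
  u @ F --> x -> v @ F --> y -> (fun i => u i ⋆ v i) @ F --> x ⋆ y.
Proof.
move=> FF ux vy.
apply: (@cvg_comp _ _ _ (fun i => (u i, v i)) (fun p => p.1 ⋆ p.2) _ (nbhs (x, y))).
  exact: cvg_pair.
exact: (tg_mul_cont (x, y)).
Qed.
Lemma tg_mull_cont c x : mul c @ x --> c ⋆ x.
Proof. by apply: tg_mul_cvg; [exact: cvg_cst|exact: cvg_id]. Qed.
Lemma tg_mulr_cont c x : mul^~ c @ x --> x ⋆ c.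
Proof. by apply: tg_mul_cvg; [exact: cvg_id|exact: cvg_cst]. Qed.
Arguments tg_mull_cont : clear implicits.
Arguments tg_mulr_cont : clear implicits.

Lemma nbhs_mull c x U : nbhs (c ⋆ x) U -> nbhs x [set y | U (c ⋆ y)].
Proof. exact: (tg_mull_cont c x). Qed.
Lemma nbhs_mulr c x U : nbhs (x ⋆ c) U -> nbhs x [set y | U (y ⋆ c)].
Proof. exact: (tg_mulr_cont c x). Qed.
Lemma nbhs_inv x U : nbhs (inv x) U -> nbhs x [set y | U (inv y)].
Proof. exact: (tg_inv_cont x). Qed.

Lemma nbhs_mul x y U : nbhs (x ⋆ y) U ->
  exists A B : set G, [/\ nbhs x A, nbhs y B & forall a b, A a -> B b -> U (a ⋆ b)].
Proof.
move=> /(tg_mul_cont (x, y)) [[A B] /= [nA nB] AB].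
by exists A, B; split => // a b Aa Bb; exact: (AB (a, b)).
Qed.

Lemma nbhs1_mul U : nbhs one U ->
  exists2 V : set G, nbhs one V & forall a b, V a -> V b -> U (a ⋆ b).
Proof.
rewrite -{1}(tg_mul1 one) => /nbhs_mul[A [B [nA nB AB]]].
by exists (A `&` B); [exact: filterI|move=> a b [Aa _] [_ Bb]; exact: AB].
Qed.

Lemma nbhs1_sym U : nbhs one U ->
  exists V : set G, [/\ nbhs one V, V `<=` U & forall a, V a -> V (inv a)].
Proof.
move=> nU; have nVU : nbhs one (inv @^-1` U).
  by apply: tg_inv_cont; rewrite tg_inv1.
exists (U `&` inv @^-1` U); split; first exact: filterI.
  by move=> a [].
by move=> a [Ua Va]; split => //=; rewrite tg_invK.
Qed.

Lemma nbhs_div (x : G) U : nbhs one U ->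
  exists2 A : set G, nbhs x A & forall a b, A a -> A b -> U (a ⋆ inv b).
Proof.
rewrite -(tg_mulrV x) => /nbhs_mul[A [B [nA nB AB]]].
exists (A `&` inv @^-1` B); first by apply: filterI => //; exact: tg_inv_cont.
by move=> a b [Aa _] [_ Bb]; exact: AB.
Qed.

Lemma compact_mul (A B : set G) : compact A -> compact B ->
  compact [set p.1 ⋆ p.2 | p in A `*` B].
Proof.
move=> cA cB; apply: continuous_compact; last exact: compact_setX.
by apply: continuous_subspaceT => p; exact: tg_mul_cont.
Qed.

Lemma compact_inv (A : set G) : compact A -> compact (inv @` A).
Proof.
move=> cA; apply: continuous_compact => //.
by apply: continuous_subspaceT => p; exact: tg_inv_cont.
Qed.

(* The syndeticity statement below is the dichotomy for locally compact
   monothetic groups (discrete or compact), applied to [int] with the group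
   topology whose neighbourhoods of [0] are the sets of [n] in [N] with [b n]
   near [one]. *)
Section Syndetic.
Hypothesis compactG : compact [set: G].
Context (b : int -> G).
Hypothesis bD : forall m n, b (m + n)%R = b m ⋆ b n.
Context (N : set int) (V : set G).
Hypothesis V_nbhs : nbhs one V.
Hypothesis N0 : N 0%R.
Hypothesis ND : forall m n, N m -> N n -> V (b (m + n)%R) -> N (m + n)%R.
Hypothesis NN : forall n, N n -> V (b (- n)%R) -> N (- n)%R.
Hypothesis N_recurrent : forall U, nbhs one U -> exists n, [/\ n <> 0%R, N n & U (b n)].

Lemma b0 : b 0%R = one.
Proof. by rewrite -(tg_mulK (b 0%R) (b 0%R)) -bD addr0 tg_mulV. Qed.

Lemma bN n : b (- n)%R = inv (b n).
Proof. by apply: tg_inv_eq; rewrite -bD addrN b0. Qed.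

(** [ND] accepts a sum only if its image lies in [V], so [U'] is shrunk until all the partial sums
    of [k] copies of [n] stay there. *)
Lemma local_multiples (k : nat) U : nbhs one U ->
  exists2 U' : set G, nbhs one U' &
    forall n, N n -> U' (b n) -> N (n *+ k)%R /\ U (b (n *+ k)%R).
Proof.
elim: k U => [|k IH] U nU.
  exists U => // n _ _; rewrite mulr0n b0.
  by split => //; exact: nbhs_singleton.
have [U1 nU1 U1U] := nbhs1_mul (filterI nU V_nbhs).
have [U2 nU2 U2U] := IH _ nU1.
exists (U1 `&` U2); first exact: filterI.
move=> n Nn [U1n /(U2U _ Nn)[Nkn U1kn]].
have [Un Vn] := U1U _ _ U1n U1kn.
by rewrite mulrS bD; split => //; apply: ND; rewrite // bD.
Qed.

(** A nonzero [n] with [b n] very close to [one] has its [k]-th multiple still in [N]; since [n] has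
    absolute value at least 1, that multiple or its opposite is at least [k]. *)
Lemma local_large (k : nat) U : nbhs one U ->
  exists n, [/\ (k%:Z <= n)%R, N n & U (b n)].
Proof.
move=> nU; have [U1 [nU1 U1U U1sym]] := nbhs1_sym (filterI nU V_nbhs).
have [U2 nU2 U2P] := local_multiples k nU1.
have [n [n0 Nn /(U2P _ Nn)[Nkn U1kn]]] := N_recurrent nU2.
have U1Nkn : U1 (b (- (n *+ k))%R) by rewrite bN; exact: U1sym.
have [n_gt0|n_lt0] : (0 < n)%R \/ (n < 0)%R by lia.
- exists (n *+ k)%R; split => //; last by have [] := U1U _ U1kn.
  by rewrite -mulr_natr; nia.
- exists (- (n *+ k))%R; split => //; last by have [] := U1U _ U1Nkn.
    by rewrite -mulr_natr; nia.
  by apply: NN => //; have [] := U1U _ U1Nkn.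
Qed.

(** Total boundedness: near a point of [G] approached by [b] on [N'], one [m] serves every nearby
    [b n]; compactness makes the bound on [m] uniform. *)
Lemma local_precompact (N' : set int) U : nbhs one U ->
  exists l : nat, forall n, N' n -> exists m,
    [/\ N' m, (`|m|%N <= l)%N & U (b n ⋆ inv (b m))].
Proof.
move=> nU; pose P (l : nat) x := forall n, N' n -> x = b n ->
  exists m, [/\ N' m, (`|m|%N <= l)%N & U (x ⋆ inv (b m))].
have /compact_near_coveringP cov := compactG.
have [] := cov _ \oo P _ _.
  move=> x _; have [A nA AU] := nbhs_div x nU.
  have [[m [Nm Am]]|nex] := pselect (exists m, N' m /\ A (b m)).
    exists (A, [set l | (`|m|%N <= l)%N]).
      by split => //; exists `|m|%N.
    move=> [x' l] /= [Ax' ml] n Nn x'n; exists m; split => //; exact: AU.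
  exists (A, setT); first by split => //; exact: filterT.
  by move=> [x' l] /= [Ax' _] n Nn x'n; case: nex; exists n; rewrite -x'n.
move=> l _ Pl; exists l => n Nn; exact: (Pl l (leqnn l) (b n) I n Nn erefl).
Qed.

Lemma syndetic U : nbhs one U -> exists l : nat, forall m, exists n,
  [/\ N n, U (b n) & (`|(m - n)%R|%N <= l)%N].
Proof.
move=> nU; have [U0 [nU0 U0U U0sym]] := nbhs1_sym (filterI nU V_nbhs).
have [U1 nU1 U1U] := nbhs1_mul nU0.
have U1sub a : U1 a -> U0 a.
  by move=> U1a; rewrite -(tg_mulr1 a); apply: U1U => //; exact: nbhs_singleton.
have U0b n : U0 (b n) -> U0 (b (- n)%R) by rewrite bN; exact: U0sym.
have [l lP] := local_precompact (fun n => N n /\ U0 (b n)) nU1.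
have [t [lt Nt U1t]] := local_large l.+1 nU1.
(* Take [q' = q - m + t]: [b (q - m)] and [b t] lie in [U1], so [b q'] lies in [U0]. Since [t]
   exceeds [l], which bounds [m], the step [t - m] is positive and at most [t + l]. *)
have next q : N q -> U0 (b q) ->
    exists q', [/\ N q', U0 (b q'), (q < q')%R & (q' <= q + t + l%:Z)%R].
  move=> Nq U0q; have [m [[Nm U0m] ml U1qm]] := lP q (conj Nq U0q).
  rewrite -bN -bD in U1qm.
  have [Um Vm] := U0U _ (U0b _ U0m); have [_ Vqm] := U0U _ (U1sub _ U1qm).
  have Nqm : N (q - m)%R by apply: ND => //; exact: NN.
  have U0qmt : U0 (b (q - m + t)%R) by rewrite bD; exact: U1U.
  have [_ Vqmt] := U0U _ U0qmt.
  by exists (q - m + t)%R; split => //; [exact: ND|lia|lia].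
have pos (k : nat) : exists q,
    [/\ N q, U0 (b q), (q <= k%:Z)%R & (k%:Z < q + t + l%:Z)%R].
  elim: k => [|k [q [Nq U0q qk kq]]].
    by exists 0%R; split => //; [rewrite b0; exact: nbhs_singleton|lia].
  have [kq'|kq'] := ltrP (k.+1%:Z)%R (q + t + l%:Z)%R.
    by exists q; split => //; lia.
  have [q' [Nq' U0q' qq' q'q]] := next q Nq U0q.
  by exists q'; split => //; lia.
exists `|(t + l%:Z)%R|%N => m.
have [q [Nq U0q qm mq]] := pos `|m|%N.
have [Uq Vq] := U0U _ U0q; have [UNq VNq] := U0U _ (U0b _ U0q).
have [m0|m0] := lerP 0%R m.
  by exists q; split => //; lia.
by exists (- q)%R; split => //; [exact: NN|lia].
Qed.

End Syndetic.

(** * The lower central series *)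

Local Notation lower_central := (lower_central mul inv one).

Lemma lower_central_subgroup k : is_subgroup mul inv one (lower_central k).
Proof.
case: k => [//|k]; split=> [H [] //|x y gx gy H sH SH|x gx H sH SH].
  by have [_ HM _] := sH; apply: HM; [exact: gx|exact: gy].
by have [_ _ HV] := sH; apply: HV; exact: gx.
Qed.

Lemma lower_central_normal k c z :
  lower_central k z -> lower_central k (inv c ⋆ z ⋆ c).
Proof.
elim: k z => [//|k IH] z gz H sH SH; have [H1 HM HV] := sH.
apply: (gz [set z | H (inv c ⋆ z ⋆ c)]).
  split=> [|x y /= Hx Hy|x /= Hx].
  - by rewrite /= tg_mulr1 tg_mulV.
  - by have := HM _ _ Hx Hy; rewrite !tgE.
  - by have := HV _ Hx; rewrite !tgE.
move=> _ [x [y [ky ->]]]; apply: SH.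
exists (inv c ⋆ x ⋆ c), (inv c ⋆ y ⋆ c); split; first exact: IH.
by rewrite /commutator !tgE.
Qed.

Lemma lower_central_commutator k c z : lower_central k z ->
  lower_central k.+1 (commutator mul inv c z).
Proof. by move=> kz H sH; apply; exists c, z. Qed.

Lemma lower_centralS k : lower_central k.+1 `<=` lower_central k.
Proof.
have [_ kM kV] := lower_central_subgroup k.
move=> z /(_ _ (lower_central_subgroup k)); apply => _ [x [y [ky ->]]].
rewrite /commutator -tg_mulA.
by apply: kM => //; apply: lower_central_normal; exact: kV.
Qed.

End TopologicalGroup.

(** * Connectedness and small neighbourhoods *)

Lemma connected_locally_constant (X : topologicalType) (A : set X) (P : X -> Prop) :
  connected A -> open A ->
  (forall x, A x -> \forall x' \near x, A x' -> P x <-> P x') ->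
  forall x y, A x -> A y -> P x -> P y.
Proof.
move=> cA oA locP x y Ax Ay Px.
have oAP (Q : X -> Prop) :
    (forall x, A x -> \forall x' \near x, A x' -> Q x -> Q x') -> open (A `&` Q).
  move=> locQ; rewrite openE => z [Az Qz].
  have nA : nbhs z A by exact: open_nbhs_nbhs.
  by apply: filterS (filterI nA (locQ z Az)) => z' [Az' /(_ Az' Qz)].
suff AP : A `&` P = A by move: Ay; rewrite -AP => -[].
apply: cA; first by exists x.
- exists (A `&` P); last by rewrite setIA setIid.
  by apply: oAP => z Az; apply: filterS (locP z Az) => z' /[apply] -[].
- exists (~` (A `&` ~` P)).
    apply: open_closedC; apply: oAP => z Az.
    by apply: filterS (locP z Az) => z' /[apply] -[_ PP] nPz /PP.
  rewrite predeqE => z; split => [[Az Pz]|[Az nP]]; split => //.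
    by move=> [_].
  by apply: contrapT => nPz; exact: nP.
Qed.

Lemma nbhs_bounded (T : topologicalType) (F : int -> set T) (p : T) (l : nat) :
  (forall k, nbhs p (F k)) ->
  nbhs p [set q | forall k, (`|k|%N <= l)%N -> F k q].
Proof.
move=> nF; elim: l => [|l IH].
  by apply: filterS (nF 0%R) => q Fq k; rewrite leqn0 absz_eq0 => /eqP ->.
apply: filterS (filterI IH (filterI (nF (Posz l.+1)) (nF (- Posz l.+1)%R))).
move=> q [IHq [F1q F2q]] k kl; have [|kl'] := leqP `|k|%N l; first exact: IHq.
by have [->|->] : k = Posz l.+1 \/ k = (- Posz l.+1)%R by lia.
Qed.

Lemma nbhs_fst (X Y : topologicalType) (p : X * Y) A :
  nbhs p.1 A -> nbhs p [set q | A q.1].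
Proof. by case: p => x y; exact: cvg_fst. Qed.

Lemma nbhs_snd (X Y : topologicalType) (p : X * Y) A :
  nbhs p.2 A -> nbhs p [set q | A q.2].
Proof. by case: p => x y; exact: cvg_snd. Qed.
Definition small_compact_nbhs (Z : topologicalType) := forall (z : Z) A,
  nbhs z A -> exists M, [/\ compact M, closed M, nbhs z M & M `<=` A].

Lemma small_compact_nbhs_prod (Y Z : topologicalType) :
  small_compact_nbhs Y -> small_compact_nbhs Z -> small_compact_nbhs (Y * Z)%type.
Proof.
move=> HY HZ [y z] A [[A1 A2] /= [/HY[M1 [c1 cl1 n1 s1]] /HZ[M2 [c2 cl2 n2 s2]]] A12].
exists (M1 `*` M2); split.
- exact: compact_setX.
- move=> p clp; split => /=.
    by apply: cl1 => B /nbhs_fst /clp[q [[M1q _] Bq]]; exists q.1.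
  by apply: cl2 => B /nbhs_snd /clp[q [[_ M2q] Bq]]; exists q.2.
- by exists (M1, M2).
- by apply: subset_trans A12; exact: setSX.
Qed.

(** * Baire category in closed subsets *)

Section Baire.
Context (Z : topologicalType).
Hypothesis Z_lcompact : small_compact_nbhs Z.

(** Nested compact neighbourhoods of points of [P] are chosen, each inside the next [D k]. If no
    point of [P] were common to them, compactness would make some [M i] miss [P], but [M i] is a
    neighbourhood of a point of [P]. *)
Lemma baire_closed (P : set Z) (D : nat -> set Z) : closed P -> P !=set0 ->
  (forall k, open (D k)) ->
  (forall k z A, P z -> nbhs z A -> exists2 q, P q & A q /\ D k q) ->
  exists2 w, P w & forall k, D k w.
Proof.
move=> cP [z0 Pz0] oD dD.
pose good (M : set Z) := [/\ compact M, closed M & exists2 z, P z & nbhs z M].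
have [M0 [cM0 clM0 nM0 _]] := Z_lcompact (@filterT _ (nbhs z0) _).
(* The guard [good i.2] makes the statement total, as [choice] requires; the set chosen is arbitrary
   when it fails. *)
have step (i : nat * set Z) : exists M', good i.2 ->
    [/\ good M', M' `<=` i.2 & M' `<=` D i.1].
  have [[_ _ [z Pz /nbhs_interior nM]]|nbad] := pselect (good i.2); last first.
    by exists set0 => /nbad.
  have [q Pq [Mq Dq]] := dD i.1 _ _ Pz nM.
  have nqD : nbhs q (D i.1) by exact: open_nbhs_nbhs.
  have [M' [cM' clM' nM' M'sub]] := Z_lcompact (filterI Mq nqD).
  exists M' => _; split.
  - by split => //; exists q.
  - by move=> x /M'sub[].
  - by move=> x /M'sub[].
have [f fP] := choice step.
pose M := fix M k := if k is k'.+1 then f (k', M k') else M0.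
have goodM k : good (M k).
  elim: k => [|k IH]; first by split => //; exists z0.
  by have [] := fP (k, M k) IH.
have MS k : M k.+1 `<=` M k by have [] := fP (k, M k) (goodM k).
have MD k : M k.+1 `<=` D k by have [] := fP (k, M k) (goodM k).
have Mle j k : (j <= k)%N -> M k `<=` M j.
  move=> /subnK <-; elim: (k - j)%N => // i IH.
  by apply: subset_trans IH; exact: MS.
suff [z [Pz Mz]] : exists z, P z /\ forall k, M k z.
  by exists z => // k; exact: MD.
apply: contrapT => nex.
have : \forall i \near \oo, M0 `<=` (fun z => ~ (P z /\ M i z)).
  move/compact_near_coveringP : cM0; apply => z _.
  have [Pz|nPz] := pselect (P z); last first.
    exists (~` P, setT) => [|[z' i] /= [nPz' _] []//].
    split; last exact: filterT.
    by apply: open_nbhs_nbhs; split => //; exact: closed_openC.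
  have [k nMk] : exists k, ~ M k z.
    by apply/existsNP => Mz; apply: nex; exists z.
  exists (~` M k, [set i | (k <= i)%N]) => [|[z' i] /= [nMz' ki] [_ /(Mle _ _ ki)]//].
  split; last by exists k.
  by apply: open_nbhs_nbhs; split => //; apply: closed_openC; have [] := goodM k.
move=> [i _ Mi]; have [_ _ [z Pz /nbhs_singleton Mz]] := goodM i.
by case: (Mi i (leqnn i) z) => //; exact: (Mle 0 i).
Qed.

End Baire.

(** * Countable bases and metrizability *)

Definition countable_base (Z : topologicalType) := exists2 f : nat -> set Z,
  forall i, open (f i) & forall (z : Z) A, nbhs z A -> exists2 i, f i z & f i `<=` A.

Lemma second_countable_base (Z : topologicalType) :
  @second_countable Z -> countable_base Z.
Proof.
move=> [B /countable_injP[f finj] [oB nB]].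
(* By injectivity of [f] on [B], the union is the member of [B] coded by [i], or empty if there is
   none. *)
exists (fun i => \bigcup_(U in [set U | B U /\ f U = i]) U).
  by move=> i; apply: bigcup_open => U [BU _]; exact: oB.
move=> z A /nB[U /= [BU Uz] UA]; exists (f U); first by exists U.
move=> y [U' [BU' fUU'] U'y]; apply: UA.
by rewrite -(finj U' U) ?inE.
Qed.

Lemma countable_base_prod (Y Z : topologicalType) :
  countable_base Y -> countable_base Z -> countable_base (Y * Z)%type.
Proof.
move=> [f of_ fP] [g og gP].
exists (fun i => if unpickle i is Some (j, k) then f j `*` g k else set0).
  move=> i; case: unpickle => [[j k]|]; last exact: open0.
  rewrite openE => -[y z] [fy gz]; exists (f j, g k) => //=.
  by split; apply: open_nbhs_nbhs.
move=> [y z] A [[A1 A2] /= [/fP[j fy fA] /gP[k gz gA]] A12].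
exists (pickle (j, k)); rewrite pickleK //=.
by apply: subset_trans A12; exact: setSX.
Qed.

Lemma compact_small_nbhs (Z : topologicalType) (V : set Z) (z : Z) A :
  hausdorff_space Z -> compact V -> nbhs z V -> nbhs z A ->
  exists M, [/\ compact M, closed M, nbhs z M & M `<=` A].
Proof.
move=> hZ cV nV nA; have [B nB BA] := compact_regular hZ cV nV nA.
have clV := compact_closed hZ cV.
exists (V `&` closure B); split.
- by apply: compact_closedI => //; exact: closed_closure.
- by apply: closedI => //; exact: closed_closure.
- by apply: filterI => //; apply: filterS nB; exact: subset_closure.
- by move=> x [_ /BA].
Qed.

Lemma locally_compact_nbhs (Z : topologicalType) :
  hausdorff_space Z -> locally_compact [set: Z] -> small_compact_nbhs Z.
Proof.
move=> hZ lcZ z A nA; have [V nV [cV _]] := lcZ z I.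
apply: (compact_small_nbhs hZ cV _ nA).
by apply: (@filterS _ (nbhs z) _ _ _ _ nV) => x /(_ I).
Qed.

Section Metrizable.
Context (X : topologicalType).
Hypothesis X_metrizable : metrizable X.

Lemma metrizable_dist : exists d : X -> X -> Rdefinitions.R,
  [/\ forall x y, (0 <= d x y)%R, forall x y, d x y = 0%R -> x = y,
      forall x y, d x y = d y x, forall x y z, (d x z <= d x y + d y z)%R &
      forall x A, nbhs x A <->
        exists2 e : Rdefinitions.R, (0 < e)%R & forall y, (d x y < e)%R -> A y].
Proof.
have [d [d0 dE dC dT nE]] := X_metrizable; exists d; split => //.
- by move=> x y; apply/RleP.
- by move=> x y /dE.
- by move=> x y z; apply/RleP.
- move=> x A; rewrite nE; split=> -[e /= /RltP e0 eA]; exists e => //.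
  + by move=> y /RltP; exact: eA.
  + by move=> y /= /RltP; exact: eA.
Qed.

Lemma metrizable_hausdorff : hausdorff_space X.
Proof.
have [d [d0 dE dC dT nE]] := metrizable_dist.
move=> p q pq; apply: dE; apply: contrapT => dpq.
have dgt0 : (0 < d p q / 2)%R by have := d0 p q; rewrite le_eqVlt => /orP[/eqP|]; lra.
have nball x : nbhs x [set z | (d x z < d p q / 2)%R].
  by apply/nE; exists (d p q / 2)%R.
have [z [/= pz qz]] := pq _ _ (nball p) (nball q).
by have := dT p z q; rewrite (dC z q); lra.
Qed.

Lemma metrizable_countable_base (u : nat -> X) :
  (forall (z : X) A, nbhs z A -> exists i, A (u i)) -> countable_base X.
Proof.
have [d [d0 dE dC dT nE]] := metrizable_dist => du.
pose ball c k := [set y | (d c y < k.+1%:R^-1)%R].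
exists (fun i => if unpickle i is Some (j, k) then (ball (u j) k)° else set0).
  by move=> i; case: unpickle => [[j k]|]; [exact: open_interior|exact: open0].
move=> z A /nE[e e0 eA].
have [k ke] : exists k, (k.+1%:R^-1 < e / 2)%R.
  have [k _ /(_ k (leqnn k))] :=
    near_infty_natSinv_lt (PosNum (divr_gt0 e0 (ltr0n _ 2))).
  by exists k.
have k0 : (0 < k.+1%:R^-1 :> Rdefinitions.R)%R by rewrite invr_gt0 ltr0n.
have nz : nbhs z (ball z k) by apply/nE; exists (k.+1%:R^-1)%R.
have [j zj] := du z (ball z k) nz.
exists (pickle (j, k)); rewrite pickleK /=.
  apply/nE; exists (k.+1%:R^-1 - d (u j) z)%R => [|y zy].
    by rewrite subr_gt0 dC; exact: zj.
  by apply: (le_lt_trans (dT _ z _)); rewrite -ltrBrDl.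
move=> y /interior_subset jy; apply: eA.
apply: (le_lt_trans (dT z (u j) y)); rewrite [e]splitr.
by apply: ltrD; apply: lt_trans ke.
Qed.

End Metrizable.

(** * Skew products over a rotation, and prolongations *)

Section Skew.
Context (X G : topologicalType) (mul : G -> G -> G) (inv : G -> G) (one : G).
Hypothesis topG : topological_group mul inv one.
Local Notation "x ⋆ y" := (mul x y) (at level 40, left associativity).

Let mulg1 := tg_mulr1 topG.
Let mulVg := tg_mulV topG.
Let mulgV := tg_mulrV topG.
Let gE := tgE topG.

Definition ract (p : X * G) (c : G) : X * G := (p.1, p.2 ⋆ c).
Local Notation "p ◁ c" := (ract p c) (at level 40, left associativity).

Lemma ractM p c d : p ◁ c ◁ d = p ◁ (c ⋆ d).
Proof. by rewrite /ract /= !gE. Qed.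
Lemma ract1 p : p ◁ one = p.
Proof. by case: p => x g; rewrite /ract /= mulg1. Qed.
Lemma ract_cont c : continuous (ract^~ c).
Proof.
move=> [x g]; apply: cvg_pair; first exact: cvg_fst.
apply: (cvg_comp _ (mul^~ c)); first exact: cvg_snd.
exact: (tg_mulr_cont topG).
Qed.
Arguments ract_cont : clear implicits.
Lemma nbhs_ract p c B : nbhs (p ◁ c) B -> nbhs p [set q | B (q ◁ c)].
Proof. exact: ract_cont. Qed.

Section Flow.
Context (mulX : X -> X -> X) (invX : X -> X) (oneX : X).
Hypothesis topX : topological_group mulX invX oneX.
Local Notation "x • y" := (mulX x y) (at level 40, left associativity).
Context (b : int -> X) (S : int -> X * G -> X * G).
Hypothesis bD : forall m n, b (m + n)%R = b m • b n.
Hypothesis S0 : forall p, S 0%R p = p.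
Hypothesis SD : forall m n p, S (m + n)%R p = S m (S n p).
Hypothesis S_cont : forall n, continuous (S n).
Hypothesis S_fst : forall n p, (S n p).1 = b n • p.1.
Hypothesis S_ract : forall n p c, S n (p ◁ c) = S n p ◁ c.

Hypothesis X_compact : compact [set: X].
Hypothesis X_lconn : locally_connected X.
Hypothesis X_lcompact : small_compact_nbhs X.
Hypothesis G_lcompact : small_compact_nbhs G.
Hypothesis XG_base : countable_base (X * G)%type.
Hypothesis b_dense : forall (x y : X) (O : set X), nbhs y O -> exists n, O (b n • x).
Hypothesis S_recurrent : forall (U : set G) (O : set X) (y : X), nbhs one U -> nbhs y O ->
  exists n x, [/\ n <> 0%R, O x, O (b n • x) & U (S n (x, one)).2].

Lemma SK n p : S (- n)%R (S n p) = p. Proof. by rewrite -SD addNr S0. Qed.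
Lemma SNK n p : S n (S (- n)%R p) = p. Proof. by rewrite -SD addrN S0. Qed.
Lemma nbhs_S n p B : nbhs (S n p) B -> nbhs p [set q | B (S n q)].
Proof. exact: S_cont. Qed.

(** The closure of the set of pairs [(v, S n v ◁ z)]. Since [v] ranges over [W] near [p], and is not
    fixed at [p], the relation can be reversed. *)
Definition prolong (W : set (X * G)) (L : set G) (p q : X * G) :=
  forall A B, nbhs p A -> nbhs q B ->
    exists n z v, [/\ L z, W v, A v & B (S n v ◁ z)].

(** [red_act], [red_fibre] and [red_onto] make every fibre of [W] one coset of [H]; [red_open] says
    that [W] projects openly to [X] and replaces local sections. *)
Record reduction (K H : set G) (W : set (X * G)) (w : X * G) : Prop := Reduction {
  red_closed : closed W;
  red_flow : forall n p, W p -> W (S n p);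
  red_subgroup : is_subgroup mul inv one H;
  red_act : forall p c, W p -> H c -> W (p ◁ c);
  red_fibre : forall x g g', W (x, g) -> W (x, g') -> H (inv g ⋆ g');
  red_onto : forall x, exists g, W (x, g);
  red_open : forall x g A, W (x, g) -> nbhs g A ->
    \forall x' \near x, exists2 g', A g' & W (x', g');
  red_sub : K `<=` H;
  red_base : W w;
  red_dense : forall p A, W p -> nbhs p A ->
    exists n z, K z /\ A (S n w ◁ z) }.

(** * The induction step: the group of essential values *)

Section Step.
Context (K L H : set G) (W : set (X * G)) (w : X * G).
Hypothesis red : reduction K H W w.
Hypothesis L_subgroup : is_subgroup mul inv one L.
Hypothesis L_normal : forall c z, L z -> L (inv c ⋆ z ⋆ c).
Hypothesis L_comm : forall c z, K z -> L (commutator mul inv c z).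
Hypothesis LK : L `<=` K.

Let L1 : L one. Proof. by case: L_subgroup. Qed.
Let LM x y : L x -> L y -> L (x ⋆ y). Proof. by case: L_subgroup => _ /(_ x y). Qed.
Let LV x : L x -> L (inv x). Proof. by case: L_subgroup => _ _ /(_ x). Qed.
Let H1 : H one. Proof. by case: (red_subgroup red). Qed.
Let HM x y : H x -> H y -> H (x ⋆ y).
Proof. by case: (red_subgroup red) => _ /(_ x y). Qed.
Let HV x : H x -> H (inv x). Proof. by case: (red_subgroup red) => _ _ /(_ x). Qed.
Let LH : L `<=` H. Proof. by move=> z /LK; exact: (red_sub red). Qed.
Let W_S n p : W p -> W (S n p). Proof. exact: (red_flow red). Qed.
Let W_act p c : W p -> H c -> W (p ◁ c). Proof. exact: (red_act red). Qed.

Lemma prolong_closed p q : prolong W L p q -> W q.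
Proof.
move=> pq; apply: (red_closed red) => B /(pq setT) [].
  exact: filterT.
move=> n [z] [v] [Lz Wv _ Bv]; exists (S n v ◁ z); split => //.
by apply: W_act; [exact: W_S|exact: LH].
Qed.

Lemma prolong_refl p : W p -> prolong W L p p.
Proof.
move=> Wp A B /nbhs_singleton Ap /nbhs_singleton Bp.
by exists 0%R, one, p; rewrite S0 ract1; split.
Qed.

Lemma prolong_flow n p q : prolong W L p q -> prolong W L (S n p) (S n q).
Proof.
move=> pq A B /nbhs_S nA /nbhs_S nB.
have [m [z [v [Lz Wv Av Bv]]]] := pq _ _ nA nB.
exists m, z, (S n v); split => //; first exact: W_S.
by move: Bv; rewrite /= S_ract -!SD addrC.
Qed.

Lemma prolong_act h p q : H h -> prolong W L p q -> prolong W L (p ◁ h) (q ◁ h).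
Proof.
move=> Hh pq A B /nbhs_ract nA /nbhs_ract nB.
have [m [z [v [Lz Wv Av Bv]]]] := pq _ _ nA nB.
exists m, (inv h ⋆ z ⋆ h), (v ◁ h); split => //.
- exact: L_normal.
- exact: W_act.
- by move: Bv; rewrite /= S_ract !ractM !gE.
Qed.

Lemma prolong_absorb z p q : L z -> prolong W L p q -> prolong W L p (q ◁ z).
Proof.
move=> Lz pq A B nA /nbhs_ract nB.
have [m [z' [v [Lz' Wv Av Bv]]]] := pq _ _ nA nB.
by exists m, (z' ⋆ z), v; split; rewrite -?ractM//; exact: LM.
Qed.

Lemma prolong_sym p q : prolong W L p q -> prolong W L q p.
Proof.
move=> pq B A nB nA; have [m [z [v [Lz Wv Av Bv]]]] := pq _ _ nA nB.
exists (- m)%R, (inv z), (S m v ◁ z); split => //; first exact: LV.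
  by apply: W_act; [exact: W_S|exact: LH].
by rewrite S_ract SK ractM gE ract1.
Qed.

Definition essential : set G := [set c | prolong W L w (w ◁ c)].
Local Notation E := essential.

(* The dense [K]-orbit of [w] carries the relation from [w] to every point:
   [c] and [z] commute modulo [L] when [z] lies in [K]. *)
Lemma essential_prolong c p : E c -> W p -> prolong W L p (p ◁ c).
Proof.
move=> Ec Wp A B nA nB.
have [n [z [Kz [/= Au Bu]]]] := red_dense red Wp
  (filterI (nbhs_interior nA) (nbhs_ract (nbhs_interior nB))).
have Hz : H z by exact: (red_sub red).
have : prolong W L (S n w ◁ z) (S n w ◁ z ◁ c).
  have := prolong_absorb (LV (L_comm c Kz)) (prolong_act Hz (prolong_flow (n := n) Ec)).
  by rewrite S_ract !ractM /commutator !gE.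
exact.
Qed.

(** Two passages are composed: one from [v] to [u = S n v ◁ z] near [q], then one from near [u] to
    near [u ◁ c], whose start is pulled back along the first to a point near [p]. *)
Lemma prolong_essential c p q : E c -> prolong W L p q -> prolong W L p (q ◁ c).
Proof.
move=> Ec pq A B nA nB.
have [n [z [v [Lz Wv Av Bv]]]] :=
  pq _ _ (nbhs_interior nA) (nbhs_ract (nbhs_interior nB)).
have Wu : W (S n v ◁ z) by apply: W_act; [exact: W_S|exact: LH].
have nA' : nbhs (S n v ◁ z) [set u | A (S (- n)%R (u ◁ inv z))].
  apply: (@nbhs_ract _ (inv z) [set u | A (S (- n)%R u)]).
  by apply: nbhs_S; rewrite ractM !gE ract1 SK.
have [m [z' [v' [Lz' Wv' /= Av' Bv']]]] := essential_prolong Ec Wu nA' Bv.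
exists (m + n)%R, (z ⋆ z'), (S (- n)%R (v' ◁ inv z)); split => //.
- exact: LM.
- by apply: W_S; apply: W_act => //; apply: HV; exact: LH.
- by rewrite SD SNK S_ract ractM !gE.
Qed.

Lemma prolong_essential_absorb p q : prolong W E p q -> prolong W L p q.
Proof.
move=> pq A B nA nB.
have [n [c [v [Ec Wv Av Bv]]]] := pq _ _ (nbhs_interior nA) (nbhs_interior nB).
have nA' : nbhs (S n v) [set u | A (S (- n)%R u)] by apply: nbhs_S; rewrite SK.
have [m [z' [v' [Lz' Wv' /= Av' Bv']]]] := essential_prolong Ec (W_S n Wv) nA' Bv.
exists (m + n)%R, z', (S (- n)%R v'); split => //; first exact: W_S.
by rewrite SD SNK.
Qed.

Lemma essential_H : E `<=` H.
Proof.
move=> c /prolong_closed; rewrite /ract => Wwc.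
by have := red_base red; case: w Wwc => x g /= /[swap] /(red_fibre red)/[apply]; rewrite !gE.
Qed.

Lemma sub_essential : L `<=` E.
Proof.
by move=> z Lz; apply: prolong_absorb => //; apply: prolong_refl; exact: (red_base red).
Qed.

Lemma essential1 : E one. Proof. exact: sub_essential. Qed.

Lemma essentialM c d : E c -> E d -> E (c ⋆ d).
Proof. by move=> Ec Ed; rewrite /essential /= -ractM; exact: prolong_essential. Qed.

Lemma essentialV c : E c -> E (inv c).
Proof.
move=> Ec; have := prolong_sym (prolong_act (HV (essential_H Ec)) Ec).
by rewrite ractM mulgV ract1.
Qed.

Lemma essential_normal h c : H h -> E c -> E (inv h ⋆ c ⋆ h).
Proof.
move=> Hh Ec; have := prolong_act Hh (essential_prolong Ec (W_act (red_base red) (HV Hh))).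
by rewrite !ractM mulVg ract1 !gE.
Qed.

(** No essential values are left modulo [E]: elements of [E] in a passage can be absorbed into the
    relation modulo [L]. *)
Lemma essential_fibre k : prolong W E w (w.1, k) -> E (inv w.2 ⋆ k).
Proof.
by move=> /prolong_essential_absorb; rewrite /essential /ract /= !gE.
Qed.

(** The preimage of the image of [B] in [G / E], which lets the quotient be treated inside [G]. *)
Definition sat (B : set G) : set G := [set g | exists2 e, E e & B (g ⋆ e)].

Lemma sub_sat B : B `<=` sat B.
Proof. by move=> g Bg; exists one; [exact: essential1|rewrite mulg1]. Qed.

Lemma sat_subset B B' : B `<=` B' -> sat B `<=` sat B'.
Proof. by move=> BB' g [e Ee /BB' ?]; exists e. Qed.

Lemma sat_act B g e : E e -> sat B (g ⋆ e) -> sat B g.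
Proof.
move=> Ee [e' Ee' Be']; exists (e ⋆ e'); first exact: essentialM.
by rewrite -(tg_mulA topG).
Qed.

Lemma sat_open B : open B -> open (sat B).
Proof.
rewrite !openE => oB g [e Ee Bge].
have nB : nbhs (g ⋆ e) B by exact: oB.
by have := nbhs_mulr topG nB; apply: filterS => g' Bg'; exists e.
Qed.

Lemma essential_closed : closed E.
Proof.
move=> c clc A B nA nB.
have nB' : nbhs c [set c' | B° (w ◁ c')].
  have [[B1 B2] /= [nB1 nB2] B12] := nbhs_interior nB.
  have := nbhs_mull topG nB2; apply: filterS => c' B2c'.
  by apply: B12; split => //=; exact: nbhs_singleton.
by have [c' [Ec' Bc']] := clc _ nB'; exact: Ec'.
Qed.

Lemma sat_closed M : compact M -> closed (sat M).
Proof.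
move=> /compact_near_coveringP cM; rewrite -[sat M]setCK; apply: open_closedC.
rewrite openE => g nMg.
have : \forall g' \near g, M `<=` (fun m => ~ E (inv g' ⋆ m)).
  apply: cM => m Mm.
  have nE : ~ E (inv g ⋆ m).
    by move=> Egm; apply: nMg; exists (inv g ⋆ m) => //; rewrite !gE.
  have nE' : nbhs (inv g ⋆ m) (~` E).
    by apply: open_nbhs_nbhs; split => //; exact: closed_openC essential_closed.
  have [A [B [nA nB AB]]] := nbhs_mul topG nE'.
  exists (B, inv @^-1` A) => /=; first by split => //; exact: (nbhs_inv topG).
  by move=> [m' g'] /= [Bm' Ag']; exact: AB.
apply: filterS => g' Mg' [e Ee Mge]; apply: (Mg' _ Mge); by rewrite !gE.
Qed.

(* As [B' `\` sat B] is compact and misses the fibre [w.2 E], no short return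
   to the fibre of [w] can land in it. *)
Lemma shell B' B : compact B' -> open B -> B w.2 ->
  exists O A, [/\ nbhs w.1 O, nbhs w.2 A &
    forall n v, W v -> O v.1 -> O (b n • v.1) -> A v.2 ->
      sat B' (S n v).2 -> sat B (S n v).2].
Proof.
move=> cB' oB Bw.
have /compact_near_coveringP cK : compact (B' `&` ~` sat B).
  by apply: compact_closedI => //; apply: open_closedC; exact: sat_open.
pose P (i : (X * G) * X) k :=
  W i.1 -> forall n e, E e -> S n i.1 ◁ e <> (i.2, k).
have [k [B'k nBk]|] := cK _ (nbhs (w, w.1)) P _.
  have : ~ prolong W E w (w.1, k).
    move=> /essential_fibre Ek; apply: nBk.
    exists (inv (inv w.2 ⋆ k)); first exact: essentialV.
    by rewrite !gE.
  move=> /existsNP[A /existsNP[Q /not_implyP[nA /not_implyP[[[Q1 Q2] /= [nQ1 nQ2] Q12] nex]]]].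
  exists (Q2, [set i | A i.1 /\ Q1 i.2]) => /=.
    by split => //; exists (A, Q1) => //= -[].
  move=> [k' [v x']] /= [Q2k' [Av Q1x']] Wv n e Ee Snv; apply: nex.
  exists n, e, v; split => //; rewrite Snv; exact: Q12.
move=> [R1 R2] /= [[[R3 A] /= [nR3 nA] RA] nR2] Rsub.
exists (R3 `&` R2), A; split => //; first exact: filterI.
move=> n v Wv [R3v _] [_ R2v] Av [e Ee B'e]; apply: contrapT => nB.
apply: (Rsub (v, b n • v.1) _ ((S n v).2 ⋆ e) _ Wv n e Ee) => /=.
- by split => //=; apply: RA.
- by split => // /(sat_act Ee).
- by rewrite /ract S_fst.
Qed.

Let phi n x := (S n (x, one)).2.

Lemma S_pair n x g : S n (x, g) = (b n • x, phi n x ⋆ g).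
Proof.
have -> : (x, g) = (x, one) ◁ g by rewrite /ract /= !gE.
by rewrite S_ract /ract S_fst.
Qed.

Lemma phiD m n x : phi (m + n)%R x = phi m (b n • x) ⋆ phi n x.
Proof.
have := S_pair (m + n)%R x one; rewrite SD !S_pair => -[_].
by rewrite !gE.
Qed.

(** * Short returns modulo the essential values *)

Section LocalGroup.
Context (C C4 A : set G) (O O1 V : set X).
Local Notation B := C°.
Local Notation y := w.1.
Local Notation g0 := w.2.
Hypothesis C_nbhs : nbhs g0 C.
Hypothesis C4P : forall b1 b2 b3 b4, C b1 -> C b2 -> C b3 -> C b4 ->
  C4 (b1 ⋆ inv g0 ⋆ b2 ⋆ (inv b3 ⋆ b4)).
Hypothesis O_shell : forall n v, W v -> O v.1 -> O (b n • v.1) -> A v.2 ->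
  sat C4 (S n v).2 -> sat B (S n v).2.
Hypothesis A_open : open A.
Hypothesis A_g0 : A g0.
Hypothesis AB : A `<=` B.
Hypothesis O_lift : forall x, O x -> exists2 g, A g & W (x, g).
Hypothesis O1_open : open O1.
Hypothesis O1_connected : connected O1.
Hypothesis O1_y : O1 y.
Hypothesis O1_O : O1 `<=` O.
Hypothesis V_nbhs : nbhs oneX V.
Hypothesis V_O1 : forall v x, V v -> O1 x -> O (v • x).
Hypothesis V_y : forall v, V v -> O1 (v • y).

Let CB : B `<=` C. Proof. exact: interior_subset. Qed.
Let Wy : W (y, g0). Proof. by have := red_base red; case: w. Qed.

(** Quantifying over the lift [g] makes this a property of [x] alone; [short_returnP] shows that
    every lift in [A] will do. *)
Definition short_return n x := exists2 g, A g & W (x, g) /\ sat B (phi n x ⋆ g).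
Local Notation Q := short_return.

(** [C4] leaves room for a left displacement [b1 ⋆ inv g0] and a change of lift [inv b3 ⋆ b4];
    normality of [E] in [H] moves the saturating element past the latter. [O_shell] then brings the
    end of a return back from [C4] to [B]. *)
Lemma sat_C4 g b1 b3 b4 : sat B g -> C b1 -> C b3 -> C b4 -> H (inv b3 ⋆ b4) ->
  sat C4 (b1 ⋆ inv g0 ⋆ g ⋆ (inv b3 ⋆ b4)).
Proof.
move=> [e Ee Bge] Cb1 Cb3 Cb4 Hb.
exists (inv (inv b3 ⋆ b4) ⋆ e ⋆ (inv b3 ⋆ b4)); first exact: essential_normal.
have := C4P Cb1 (CB Bge) Cb3 Cb4.
by rewrite !gE.
Qed.

Lemma short_returnP n x g : O x -> O (b n • x) -> A g -> W (x, g) -> Q n x ->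
  sat B (phi n x ⋆ g).
Proof.
move=> Ox Obx Ag Wg [g1 Ag1 [Wg1 Bg1]].
have := @O_shell n (x, g) Wg Ox Obx Ag; rewrite S_pair; apply.
have := sat_C4 Bg1 (CB (AB A_g0)) (CB (AB Ag1)) (CB (AB Ag)) (red_fibre red Wg1 Wg).
by rewrite !gE.
Qed.

Lemma short_return_local n x : O x -> O (b n • x) ->
  \forall x' \near x, O x' -> O (b n • x') -> Q n x <-> Q n x'.
Proof.
move=> Ox Obx; have [g Ag Wg] := O_lift Ox.
(* The ends of the returns from [x] and [x'] differ by a left factor [j] near [one]; with [j ⋆ g0]
   in [C], it is a displacement that [sat_C4] allows. *)
have nC : nbhs one [set j | C (j ⋆ g0)].
  by apply: (nbhs_mulr topG); rewrite (tg_mul1 topG).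
have [J [nJ JC Jsym]] := nbhs1_sym topG nC.
have nJ' : nbhs (S n (x, g)) [set q | J (q.2 ⋆ inv (phi n x ⋆ g))].
  rewrite S_pair; exists (setT, [set h | J (h ⋆ inv (phi n x ⋆ g))]) => /=.
    split; first exact: filterT.
    by apply: (nbhs_mulr topG); rewrite (tg_mulrV topG).
  by move=> [x' h] [].
have [[U1 U2] /= [nU1 nU2] U12] := nbhs_S nJ'.
have nAU : nbhs g (A `&` U2) by apply: filterI => //; exact: open_nbhs_nbhs.
apply: filterS (filterI nU1 (red_open red Wg nAU)) => x' [U1x' [g' [Ag' U2g'] Wg']].
move=> Ox' Obx'; have := U12 (x', g') (conj U1x' U2g').
rewrite /= S_pair /=; set j := _ ⋆ inv _ => Jj.
have jE : phi n x' ⋆ g' = j ⋆ (phi n x ⋆ g) by rewrite /j !gE.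
have Cj i : J i -> C (i ⋆ g0) by exact: JC.
have Cg : C g by exact/CB/AB.
have H1' : H (inv g ⋆ g) by rewrite (tg_mulV topG).
split=> [Qx|Qx'].
- exists g' => //; split => //.
  have := @O_shell n (x', g') Wg' Ox' Obx' Ag'; rewrite S_pair; apply.
  have := sat_C4 (short_returnP Ox Obx Ag Wg Qx) (Cj _ Jj) Cg Cg H1'.
  by rewrite /= jE !gE.
- exists g => //; split => //.
  have := @O_shell n (x, g) Wg Ox Obx Ag; rewrite S_pair; apply.
  have := sat_C4 (short_returnP Ox' Obx' Ag' Wg' Qx') (Cj _ (Jsym _ Jj)) Cg Cg H1'.
  by rewrite /= jE !gE.
Qed.

Lemma short_return_connected n x x' : V (b n) -> O1 x -> O1 x' -> Q n x -> Q n x'.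
Proof.
move=> Vn; apply: connected_locally_constant => // {}x O1x.
have := short_return_local (O1_O O1x) (V_O1 Vn O1x).
apply: filterS => {}x' loc O1x'; apply: loc; [exact: O1_O|exact: V_O1].
Qed.

Definition local_return n := V (b n) /\ forall x, O1 x -> Q n x.
Local Notation N := local_return.

(** The shell improves [C4] to [B] at [y], and connectedness of [O1] spreads the return from [y] to
    all of [O1]. *)
Lemma local_returnP n : V (b n) -> sat C4 (phi n y ⋆ g0) -> N n.
Proof.
move=> Vn C4n; split => // x O1x.
apply: (short_return_connected Vn O1_y O1x).
exists g0 => //; split => //.
have := @O_shell n (y, g0) Wy (O1_O O1_y) (V_O1 Vn O1_y) A_g0.
by rewrite S_pair; apply.
Qed.

Lemma local_return_base n : N n -> sat B (S n w).2.
Proof.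
move=> [Vn Qn]; rewrite [w]surjective_pairing S_pair.
by apply: short_returnP; [exact: O1_O|exact: V_O1|done|done|exact: Qn].
Qed.

Lemma local_return0 : N 0%R.
Proof.
have H1' : H (inv g0 ⋆ g0) by rewrite (tg_mulV topG).
apply: local_returnP.
  by rewrite (b0 topX bD); exact: nbhs_singleton.
have := sat_C4 (sub_sat (AB A_g0)) (CB (AB A_g0)) (CB (AB A_g0)) (CB (AB A_g0)) H1'.
have := S_pair 0 y one; rewrite S0 => -[_]. rewrite mulg1 => <-.
by rewrite !gE.
Qed.

(** The return [m] is applied at [b n • y], which lies in [O1]. The end of the return [n] and the
    lift [g'] used there lie in one fibre of [W], so they differ by a change of lift. *)
Lemma local_returnD m n : N m -> N n -> V (b (m + n)%R) -> N (m + n)%R.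
Proof.
move=> [Vm Qm] Nn Vmn; apply: local_returnP => //.
have [e Ee] := local_return_base Nn; rewrite [w]surjective_pairing S_pair /=.
set g1 := phi n y ⋆ g0 => Bg1.
have [g' Ag' [Wg' Bg']] := Qm _ (V_y (proj1 Nn)).
have Wg1 : W (b n • y, g1 ⋆ e).
  by have := W_act (W_S n Wy) (essential_H Ee); rewrite S_pair.
have := sat_C4 Bg' (CB (AB A_g0)) (CB (AB Ag')) (CB Bg1) (red_fibre red Wg' Wg1).
rewrite phiD -(tg_mulA topG) => C4g; apply: (@sat_act _ _ e) => //.
by move: C4g; rewrite /g1 !gE.
Qed.

Lemma local_returnN n : N n -> V (b (- n)%R) -> N (- n)%R.
Proof.
move=> [Vn Qn] VNn; apply: local_returnP => //.
(* The return [n] from [x], a point of [O1], ends over [y] at [b1]; running it backwards from [g0]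
   instead of [b1] is a change of lift. *)
set x := b (- n)%R • y.
have bx : b n • x = y by rewrite /x -(tg_mulA topX) -bD addrN (b0 topX bD) (tg_mul1 topX).
have [g Ag [Wg [e Ee Bg]]] := Qn x (V_y VNn).
set b1 := phi n x ⋆ g ⋆ e in Bg.
have -> : phi (- n)%R y ⋆ g0 = g ⋆ e ⋆ (inv b1 ⋆ g0).
  have := SK n (x, g); rewrite S_pair S_pair bx => /(congr1 snd) /= gn.
  by rewrite -{1}gn /b1 !gE.
have Wb1 : W (y, b1).
  by have := W_act (W_S n Wg) (essential_H Ee); rewrite S_pair bx.
have := sat_C4 (g := g ⋆ e) _ (CB (AB A_g0)) (CB Bg) (CB (AB A_g0)) (red_fibre red Wb1 Wy).
rewrite !gE; apply; apply: (@sat_act _ _ (inv e)); first exact: essentialV.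
by rewrite !gE; apply: sub_sat; exact: AB.
Qed.

Lemma local_return_recurrent U : nbhs oneX U ->
  exists n, [/\ n <> 0%R, N n & U (b n)].
Proof.
move=> nU; have [D2 nD2 D2U] := nbhs_div topX y (filterI nU V_nbhs).
have [J [A1 [nJ nA1 JA1]]] : exists J A1 : set G, [/\ nbhs one J, nbhs g0 A1 &
    forall i g, J i -> A1 g -> B (i ⋆ g)].
  by apply: (nbhs_mul topG); rewrite (tg_mul1 topG) //; exact: nbhs_interior.
have nAA1 : nbhs g0 (A `&` A1) by apply: filterI => //; exact: open_nbhs_nbhs.
have nD3 : nbhs y (O1 `&` (D2 `&` [set x | exists2 g, (A `&` A1) g & W (x, g)])).
  apply: filterI; first exact: open_nbhs_nbhs.
  by apply: filterI => //; exact: (red_open red Wy nAA1).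
have [n [x [n0 [ O1x [D2x [g [Ag A1g] Wg]]] [ O1bx [D2bx _]] Jn]]] := S_recurrent nJ nD3.
(* The rotation is a left translation, so [b n] is the quotient of [b n • x] by [x], both near
   [y]. *)
have [Un Vn] : (U `&` V) (b n).
  by have := D2U _ _ D2bx D2x; rewrite !(tgE topX).
exists n; split => //; split => // x' O1x'.
apply: (short_return_connected Vn O1x O1x').
by exists g => //; split => //; apply: sub_sat; exact: JA1.
Qed.

(** A second shell, between [C] and [U2], shrinks a local return to a return to [U] once [b n • y]
    is close enough to [y]; such times are syndetic. *)
Lemma local_almost_periodic U : compact C -> nbhs w U ->
  exists l : nat, forall m, exists n e,
    [/\ E e, U (S n w ◁ e) & (`|(m - n)%R|%N <= l)%N].
Proof.
move=> cC; rewrite [w]surjective_pairing => -[[U1 U2] /= [nU1 nU2] U12].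
have [ O' [A' [nO' nA' O'P]]] := shell cC (@open_interior _ U2) nU2.
have nV : nbhs oneX [set v | (O' `&` U1) (v • y)].
  by apply: (nbhs_mulr topX); rewrite (tg_mul1 topX); exact: filterI.
have [l lP] := syndetic topX X_compact bD V_nbhs local_return0 local_returnD
  local_returnN local_return_recurrent nV.
exists l => m; have [n [Nn [ O'n U1n] mn]] := lP m.
have Cn : sat C (S n w).2.
  by apply: sat_subset (local_return_base Nn); exact: interior_subset.
have [e Ee U2n] : sat U2° (S n w).2.
  apply: O'P => //; [exact: (red_base red)|exact: nbhs_singleton|].
  exact: nbhs_singleton.
exists n, e; split => //; rewrite -surjective_pairing; apply: U12; split => /=.
  by rewrite S_fst.
exact: nbhs_singleton.
Qed.

End LocalGroup.

Lemma almost_periodic U : nbhs w U -> exists l : nat, forall m, exists n e,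
  [/\ E e, U (S n w ◁ e) & (`|(m - n)%R|%N <= l)%N].
Proof.
move=> nU; have [C [cC _ nC _]] := G_lcompact (@filterT _ (nbhs w.2) _).
have Wy : W (w.1, w.2) by have := red_base red; case: w.
pose C4 := [set p.1 ⋆ p.2 | p in [set p.1 ⋆ p.2 | p in
    [set p.1 ⋆ p.2 | p in C `*` [set inv w.2]] `*` C]
  `*` [set p.1 ⋆ p.2 | p in (inv @` C) `*` C]].
have cC4 : compact C4.
  do ?[apply: (compact_mul topG) => //]; [exact: compact_set1|exact: (compact_inv topG)].
have C4P b1 b2 b3 b4 : C b1 -> C b2 -> C b3 -> C b4 ->
    C4 (b1 ⋆ inv w.2 ⋆ b2 ⋆ (inv b3 ⋆ b4)).
  move=> Cb1 Cb2 Cb3 Cb4.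
  exists (b1 ⋆ inv w.2 ⋆ b2, inv b3 ⋆ b4) => //=; split => /=.
    exists (b1 ⋆ inv w.2, b2) => //=; split => //=.
    by exists (b1, inv w.2).
  by exists (inv b3, b4) => //=; split => //=; exists b3.
have [ O0 [A0 [nO0 nA0 shell0]]] := shell cC4 (@open_interior _ C) nC.
have nA : nbhs w.2 (A0° `&` C°) by apply: filterI; exact: nbhs_interior.
pose O := O0 `&` [set x | exists2 g, (A0° `&` C°) g & W (x, g)].
have nO : nbhs w.1 O by apply: filterI => //; exact: (red_open red Wy nA).
have [V0 [D [nV0 nD V0D]]] : exists V0 D : set X, [/\ nbhs oneX V0, nbhs w.1 D &
    forall v x, V0 v -> D x -> O (v • x)].
  by apply: (nbhs_mul topX); rewrite (tg_mul1 topX).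
have [Q1 [oQ1 Q1y cQ1 Q1sub]] := X_lconn (filterI nO nD).
apply: (@local_almost_periodic C C4 (A0° `&` C°) O Q1
  (V0 `&` [set v | Q1 (v • w.1)])) => //.
- move=> n v Wv [ O0v _] [ O0bv _] [A0v _]; apply: shell0 => //.
  exact: interior_subset.
- by apply: openI; exact: open_interior.
- by move=> g [].
- by move=> x /Q1sub[].
- apply: filterI => //; apply: (nbhs_mulr topX); rewrite (tg_mul1 topX).
  exact: open_nbhs_nbhs.
- by move=> v x [V0v _] /Q1sub[_ Dx]; exact: V0D.
- by move=> v [].
Qed.

(** * The orbit closure modulo the essential values *)

Lemma translates_compact C (l : nat) : compact C -> exists2 M, compact M &
  forall k p, (`|k|%N <= l)%N -> C p.2 -> M (S k p).2.
Proof.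
move=> cC.
pose F k := (fun p => (S k p).2) @` ([set: X] `*` C).
have cF k : compact (F k).
  apply: continuous_compact; last exact: compact_setX.
  apply: continuous_subspaceT => p.
  by apply: cvg_comp; [exact: S_cont|exact: cvg_snd].
elim: l => [|l [M cM MP]].
  by exists (F 0%R) => // k p; rewrite leqn0 absz_eq0 => /eqP -> Cp; exists p.
exists (M `|` (F (Posz l.+1) `|` F (- Posz l.+1)%R)).
  by do ?apply: compactU.
move=> k p kl Cp; have [kl'|kl'] := leqP `|k|%N l; first by left; exact: MP.
have [->|->] : k = Posz l.+1 \/ k = (- Posz l.+1)%R by lia.
  by right; left; exists p.
by right; right; exists p.
Qed.

(** Every time is within [l] of a return to the compact set [C], and boundedly many steps keep the
    second coordinate in a compact set. *)
Lemma orbit_bounded : exists2 M, compact M & forall m, sat M (S m w).2.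
Proof.
have [C [cC _ nC _]] := G_lcompact (@filterT _ (nbhs w.2) _).
have nU : nbhs w [set q | C q.2] by exact: nbhs_snd.
have [l lP] := almost_periodic nU.
have [M cM MP] := translates_compact l cC.
exists M => // m; have [n [e [Ee Cn mn]]] := lP m.
exists e => //; have := MP _ _ mn Cn.
by rewrite S_ract -SD subrK.
Qed.

(** The preimage in [W] of the orbit closure of the point [w E] of [W / E]. *)
Definition orbit_hull : set (X * G) :=
  closure [set q | exists n e, E e /\ q = S n w ◁ e].
Local Notation P := orbit_hull.

Lemma hull_nbhs (A : set (X * G)) p : P p -> nbhs p A ->
  exists n e, E e /\ A (S n w ◁ e).
Proof. by move=> Pp /Pp[q [[n [e [Ee ->]]] Aq]]; exists n, e. Qed.

Lemma nbhs_hull p : (forall A, nbhs p A -> exists n e, E e /\ A (S n w ◁ e)) -> P p.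
Proof.
move=> pP A /pP[n [e [Ee An]]]; exists (S n w ◁ e); split => //.
by exists n, e.
Qed.

Lemma hull_base : P w.
Proof.
apply: nbhs_hull => A /nbhs_singleton Aw; exists 0%R, one.
by rewrite S0 ract1; split => //; exact: essential1.
Qed.

Lemma hull_flow n p : P p -> P (S n p).
Proof.
move=> Pp; apply: nbhs_hull => A /nbhs_S /(hull_nbhs Pp)[m [e [Ee Am]]].
by exists (n + m)%R, e; rewrite SD -S_ract.
Qed.

Lemma hull_act p e : P p -> E e -> P (p ◁ e).
Proof.
move=> Pp Ee; apply: nbhs_hull => A /nbhs_ract /(hull_nbhs Pp)[m [e' [Ee' Am]]].
by exists m, (e' ⋆ e); rewrite -ractM; split => //; exact: essentialM.
Qed.

Lemma hull_sub : P `<=` W.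
Proof.
move=> p Pp; apply: (red_closed red) => A /(hull_nbhs Pp)[n [e [Ee An]]].
exists (S n w ◁ e); split => //; apply: W_act; last exact: essential_H.
by apply: W_S; exact: (red_base red).
Qed.

Lemma hull_sat M p : compact M -> (forall m, sat M (S m w).2) -> P p -> sat M p.2.
Proof.
move=> cM Mw Pp; apply: (sat_closed cM) => A nA.
have nA' : nbhs p [set q | A q.2] by exact: nbhs_snd.
have [n [e [Ee An]]] := hull_nbhs Pp nA'.
exists ((S n w).2 ⋆ e); split => //; apply: (sat_act (essentialV Ee)).
by rewrite !gE.
Qed.

(* The returns of the orbit of [w] have bounded gaps, so one of finitely many
   translates of [p] lies in the (closed) [E]-saturation of a small compact
   neighbourhood. *)
Lemma hull_return p U : P p -> nbhs w U -> exists n e, E e /\ U (S n p ◁ e).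
Proof.
move=> Pp; rewrite [w]surjective_pairing => -[[U1 U2] /= [nU1 nU2] U12].
have [C [cC _ nC CU2]] := G_lcompact nU2.
have [Q [V [nQ nV QV]]] : exists Q V : set X, [/\ nbhs w.1 Q, nbhs oneX V &
    forall x v, Q x -> V v -> U1 (x • v)].
  by apply: (nbhs_mul topX); rewrite (tg_mulr1 topX).
have nU : nbhs w [set q | Q q.1 /\ C q.2].
  exact: filterI (nbhs_fst nQ) (nbhs_snd nC).
have [l lP] := almost_periodic nU.
apply: contrapT => nex.
pose F k := [set q | sat C (S k q).2 -> sat C (S k p).2].
have nF k : nbhs p (F k).
  have [Cp|nCp] := pselect (sat C (S k p).2).
    by apply: filterE => q.
  have nC' : nbhs (S k p) [set q | ~ sat C q.2].
    apply: (nbhs_snd (A := ~` sat C)); apply: open_nbhs_nbhs; split => //.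
    exact: closed_openC (sat_closed cC).
  by apply: filterS (nbhs_S nC') => q nCq /nCq.
have nV' : nbhs p [set q | V (invX q.1 • p.1)].
  apply: (nbhs_fst (A := [set x | V (invX x • p.1)])).
  apply: (nbhs_inv topX (U := [set x | V (x • p.1)])); apply: (nbhs_mulr topX).
  by rewrite (tg_mulV topX).
have [m [e [Ee [Fm Vm]]]] := hull_nbhs Pp (filterI (nbhs_bounded l nF) nV').
have [n [e' [Ee' [Qn Cn] mn]]] := lP m.
have nm : (`|(n - m)%R|%N <= l)%N by lia.
have SE : S (n - m)%R (S m w ◁ e) = S n w ◁ e by rewrite S_ract -SD subrK.
have [e2 Ee2 Ce2] : sat C (S (n - m)%R p).2.
  apply: Fm => //; rewrite SE; exists (inv e ⋆ e').
    by apply: essentialM => //; exact: essentialV.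
  by move: Cn; rewrite /= !gE.
apply: nex; exists (n - m)%R, e2; split => //.
rewrite [_ ◁ _]surjective_pairing; apply: U12; split => /=; last exact: CU2.
rewrite S_fst.
(* Left rotation preserves the right offset from [(S m w).1] to [p.1], so it is still in [V] at time
   [n]. *)
have -> : b (n - m)%R • p.1 = (S n w).1 • (invX (S m w).1 • p.1).
  by rewrite !S_fst bD (bN topX bD) !(tgE topX).
by apply: QV.
Qed.

Lemma hull_minimal p q U : P p -> P q -> nbhs q U -> exists n e, E e /\ U (S n p ◁ e).
Proof.
move=> Pp Pq /nbhs_interior /(hull_nbhs Pq)[m [e [Ee Um]]].
have nU : nbhs w [set v | U (S m v ◁ e)].
  by apply: (nbhs_S (B := [set v | U (v ◁ e)])); apply: nbhs_ract.
have [n [e' [Ee' Un]]] := hull_return Pp nU.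
exists (m + n)%R, (e' ⋆ e); split; first exact: essentialM.
by move: Un; rewrite /= S_ract ractM SD.
Qed.

Lemma hull_prolong q : P q -> prolong W E w q.
Proof.
move=> Pq A B /nbhs_singleton Aw /(hull_nbhs Pq)[n [e [Ee Bn]]].
by exists n, e, w; split => //; exact: (red_base red).
Qed.

(** The orbit of [(x, g)] approaches [w] modulo [E]; translated by [c], this puts [w ◁ c] in the
    hull, so [c] is an essential value. *)
Lemma hull_fibre x g g' : P (x, g) -> P (x, g') -> E (inv g ⋆ g').
Proof.
move=> Pg Pg'; set c := inv g ⋆ g'.
have Hc : H c by exact: (red_fibre red (hull_sub Pg) (hull_sub Pg')).
have gc : (x, g') = (x, g) ◁ c by rewrite /ract /c /= !gE.
have Pwc : P (w ◁ c).
  apply: nbhs_hull => A /nbhs_interior /nbhs_ract /(hull_return Pg)[n [e [Ee An]]].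
  have Pn : P (S n (x, g') ◁ (inv c ⋆ e ⋆ c)).
    by apply: hull_act; [exact: hull_flow|exact: essential_normal].
  by apply: (hull_nbhs Pn); move: An; rewrite /= gc S_ract !ractM !gE.
by have := essential_fibre (hull_prolong Pwc); rewrite /= !gE.
Qed.

(** As [E] moves every orbit point into a compact [M], a point without lift has a neighbourhood over
    which the hull misses [M]; the dense orbit of [w.1] enters it. *)
Lemma hull_onto x : exists g, P (x, g).
Proof.
have [M cM Mw] := orbit_bounded; apply: contrapT => nex.
have : \forall x' \near x, M `<=` (fun m => ~ P (x', m)).
  move/compact_near_coveringP : cM; apply => m _.
  have /nbhs_interior : nbhs (x, m) (~` P).
    apply: open_nbhs_nbhs; split; last by move=> Pm; apply: nex; exists m.
    exact/closed_openC/closed_closure.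
  move=> [[A1 A2] /= [nA1 nA2] A12]; exists (A2, A1) => //= -[m' x'] /= [A2m' A1x'].
  exact: nbhs_singleton (A12 (x', m') (conj A1x' A2m')).
move=> /(b_dense w.1)[n Mn]; have [e Ee Me] := Mw n.
apply: (Mn _ Me); have := hull_act (hull_flow (n := n) hull_base) Ee.
by rewrite /ract S_fst.
Qed.

Lemma hull_open x g A : P (x, g) -> nbhs g A ->
  \forall x' \near x, exists2 g', A g' & P (x', g').
Proof.
move=> Pg nA; have [M cM Mw] := orbit_bounded.
have : \forall x' \near x, M `<=` (fun m => P (x', m) -> exists2 g', A g' & P (x', g')).
  move/compact_near_coveringP : (cM); apply => m _.
  (* If [(x, m)] is in the hull, [inv m ⋆ g] lies in [E] and carries hull points near it into [A];
     otherwise the hull misses a neighbourhood of it. *)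
  have [Pm|nPm] := pselect (P (x, m)).
    have Ee := hull_fibre Pm Pg; have nA' : nbhs m [set m' | A (m' ⋆ (inv m ⋆ g))].
      by apply: (nbhs_mulr topG); rewrite !gE.
    exists ([set m' | A (m' ⋆ (inv m ⋆ g))], setT); first by split => //; exact: filterT.
    move=> [m' x'] /= [Am' _] Pm'; exists (m' ⋆ (inv m ⋆ g)) => //.
    exact: (hull_act Pm' Ee).
  have : nbhs (x, m) (~` P).
    by apply: open_nbhs_nbhs; split => //; exact/closed_openC/closed_closure.
  move=> [[A1 A2] /= [nA1 nA2] A12]; exists (A2, A1) => //= -[m' x'] /= [A2m' A1x'] Pm'.
  by case: (A12 (x', m')).
apply: filterS => x' MA; have [g' Pg'] := hull_onto x'.
have [e Ee Me] := hull_sat cM Mw Pg'.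
exact: (MA _ Me (hull_act Pg' Ee)).
Qed.

(** [essential_prolong] gives a start [(x', g')] in [W] only. It is replaced by a hull point
    [(x', g2)] over the same [x']; the small correction [h] conjugates [z], which stays in the
    normal [L], and barely moves the end. *)
Lemma hull_prolong_all p q : P p -> P q -> prolong P L p q.
Proof.
move=> Pp Pq A B nA nB.
have [n [e [Ee Be]]] := hull_minimal Pp Pq (nbhs_interior nB).
set p1 := S n p in Be; have Pp1 : P p1 by exact: hull_flow.
have nA1 : nbhs p1 [set v | A (S (- n)%R v)] by apply: nbhs_S; rewrite SK.
have [J [nJ [B1 [nB1 JB1]]]] : exists J : set G, nbhs one J /\
    exists B1, nbhs (p1 ◁ e) B1 /\ forall v j, B1 v -> J j -> B (v ◁ j).
  have [[D1 D2] /= [nD1 nD2] D12] := nbhs_interior Be.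
  have [D3 [J [nD3 nJ DJ]]] : exists D3 J : set G, [/\ nbhs (p1 ◁ e).2 D3, nbhs one J &
      forall g j, D3 g -> J j -> D2 (g ⋆ j)].
    by apply: (nbhs_mul topG); rewrite mulg1.
  exists J; split => //; exists [set v | D1 v.1 /\ D3 v.2]; split.
    by exists (D1, D3).
  move=> v j [D1v D3v] Jj; apply: nbhs_singleton.
  by apply: D12; split => //=; exact: DJ.
have [J2 [nJ2 J2J J2sym]] := nbhs1_sym topG nJ.
have [D nD DJ] : exists2 D : set G, nbhs p1.2 D & forall g g', D g -> D g' -> J2 (inv g ⋆ g').
  have [D nD DJ] := nbhs_div topG (inv p1.2) nJ2.
  exists [set g | D (inv g)]; first exact: (nbhs_inv topG).
  by move=> g g' Dg Dg'; have := DJ _ _ Dg Dg'; rewrite !gE.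
have [[R1 R2] /= [nR1 nR2] R12] := nA1.
have nDR : nbhs p1.2 (D `&` R2) by exact: filterI.
have Pp1' : P (p1.1, p1.2) by rewrite -surjective_pairing.
pose R := [set x' | exists2 g, (D `&` R2) g & P (x', g)].
have nA2 : nbhs p1 ([set q | (R1 `&` R) q.1] `&` [set q | D q.2]).
  apply: filterI; last exact: nbhs_snd.
  by apply: nbhs_fst; apply: filterI => //; exact: hull_open nDR.
have [m [z [[x' g'] [Lz Wv /= [[R1x [g2 [Dg2 R2g2] Pg2]] Dg'] B1v]]]] :=
  essential_prolong Ee (hull_sub Pp1) nA2 nB1.
set h := inv g2 ⋆ g'; have J2h : J2 (inv h) by apply: J2sym; exact: DJ.
have hE : (x', g') = (x', g2) ◁ h by rewrite /ract /h /= !gE.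
exists (m + n)%R, (h ⋆ z ⋆ inv h), (S (- n)%R (x', g2)); split.
- by rewrite -{1}[h](tg_invK topG); exact: L_normal.
- exact: hull_flow.
- exact: (R12 (x', g2)).
- have := JB1 _ _ B1v (J2J _ J2h).
  by rewrite hE S_ract !ractM SD SNK !gE.
Qed.

Lemma hull_dense : exists2 u, P u & forall p A, P p -> nbhs p A ->
  exists n z, L z /\ A (S n u ◁ z).
Proof.
have [f fo fP] := XG_base.
(* Basic sets that miss the hull impose no condition; for the others [hull_prolong_all] gives
   density. *)
pose D i := [set u | P `&` f i !=set0 -> exists n z, L z /\ f i (S n u ◁ z)].
have [u Pu Du] : exists2 u, P u & forall i, D i u.
  apply: baire_closed.
  - exact: small_compact_nbhs_prod X_lcompact G_lcompact.
  - exact: closed_closure.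
  - by exists w; exact: hull_base.
  - move=> i; rewrite openE => u Du.
    have [/Du[n [z [Lz fu]]]|nPf] := pselect (P `&` f i !=set0); last first.
      by apply: filterE => u' /nPf.
    have : nbhs u [set u' | f i (S n u' ◁ z)].
      apply: (nbhs_S (B := [set u' | f i (u' ◁ z)])); apply: nbhs_ract.
      exact: open_nbhs_nbhs.
    by apply: filterS => u' fu' _; exists n, z.
  - move=> i p A Pp nA; have [[q [Pq fq]]|nPf] := pselect (P `&` f i !=set0).
      have nq : nbhs q (f i) by exact: open_nbhs_nbhs.
      have [n [z [v [Lz Pv Av fv]]]] := hull_prolong_all Pp Pq nA nq.
      by exists v => //; split => // _; exists n, z.
    by exists p => //; split; [exact: nbhs_singleton|move=> /nPf].
exists u => // p A Pp /fP[i fp fA].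
by have [|n [z [Lz fu]]] := Du i; [exists p|exists n, z; split => //; exact: fA].
Qed.

Lemma reduction_hull : exists u, reduction L E P u.
Proof.
have [u Pu uP] := hull_dense; exists u; split => //.
- exact: closed_closure.
- exact: hull_flow.
- by split; [exact: essential1|exact: essentialM|exact: essentialV].
- exact: hull_act.
- exact: hull_fibre.
- exact: hull_onto.
- exact: hull_open.
- exact: sub_essential.
Qed.

End Step.

(** * The induction on the lower central series *)

Lemma reduction_lower_central k : exists H W w,
  reduction (lower_central mul inv one k) H W w.
Proof.
elim: k => [|k [H [W [w red]]]]; last first.
  have [u redu] := reduction_hull red (lower_central_subgroup mul inv one k.+1)
    (fun c z => @lower_central_normal _ _ _ _ topG k.+1 c z)
    (fun c z => @lower_central_commutator _ _ _ _ k c z)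
    (@lower_centralS _ _ _ _ topG k).
  by exists (essential (lower_central mul inv one k.+1) W w),
    (orbit_hull (lower_central mul inv one k.+1) W w), u.
(* The series starts with all of [G], so density modulo it only asks the base orbit to be dense. *)
exists setT, setT, (oneX, one); split => //.
- by move=> x; exists one.
- by move=> x g A _ /nbhs_singleton Ag; apply: filterE => x'; exists g.
- move=> [x g] A _ [[A1 A2] /= [nA1 nA2] A12].
  have [n A1n] := b_dense oneX nA1.
  exists n, (inv (S n (oneX, one)).2 ⋆ g); split => //; apply: A12; split => /=.
    by rewrite S_fst.
  by rewrite !gE; exact: nbhs_singleton.
Qed.

Lemma nilpotent_regular : nilpotent_group mul inv one ->
  exists p, forall x : X, exists g : G, forall A,
    nbhs (x, g) A -> exists n, A (S n p).
Proof.
move=> [k kE]; have [H [W [w red]]] := reduction_lower_central k.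
exists w => x; have [g Wg] := red_onto red x; exists g => A nA.
have [n [z []]] := red_dense red Wg nA.
by rewrite kE => /= ->; rewrite ract1; exists n.
Qed.

End Flow.
End Skew.

(** * Integer iterates and the given rotation *)

Section Iterates.
Context (Y : Type) (F Finv : Y -> Y).
Hypothesis FK : cancel F Finv.
Hypothesis FKV : cancel Finv F.

Lemma iter_zS n y : iter_z F Finv (n + 1)%R y = F (iter_z F Finv n y).
Proof.
case: n => [n|[|n]]; [by rewrite /= addn1|by rewrite /= FKV|].
have -> : (Negz n.+1 + 1 = Negz n)%R by lia.
by rewrite /= FKV.
Qed.

Lemma iter_zD m n y :
  iter_z F Finv (m + n)%R y = iter_z F Finv m (iter_z F Finv n y).
Proof.
have up k z : iter_z F Finv (k - 1)%R z = Finv (iter_z F Finv k z).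
  by rewrite -{2}(subrK 1%R k) iter_zS FK.
elim/int_ind: m => [|m IH|m IH]; first by rewrite add0r.
- have -> : (m.+1%:Z + n = (m%:Z + n) + 1)%R by lia.
  by rewrite iter_zS IH.
- have -> : (- m.+1%:Z = - m%:Z - 1)%R by lia.
  by rewrite addrAC !up IH.
Qed.

End Iterates.

Theorem theorem4p6
  (X : topologicalType) (mulX : X -> X -> X) (invX : X -> X) (oneX : X)
  (G : topologicalType) (mulG : G -> G -> G) (invG : G -> G) (oneG : G)
  (a : X) (f : X -> G) :
  (* X: locally connected compact metrizable group *)
  topological_group mulX invX oneX ->
  compact [set: X] -> metrizable X -> locally_connected X ->
  (* G: nilpotent locally compact second countable (Hausdorff) group *)
  topological_group mulG invG oneG ->
  nilpotent_group mulG invG oneG ->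
  hausdorff_space G -> locally_compact [set: G] -> @second_countable G ->
  (* T x = a x is a minimal rotation *)
  minimal_homeo (mulX a) (mulX (invX a)) ->
  (* f continuous and topologically recurrent *)
  continuous f ->
  top_recurrent mulG invG oneG (mulX a) (mulX (invX a)) f ->
  regular_cocycle mulG invG (mulX a) (mulX (invX a)) f.
Proof.
move=> topX cX mX lX topG nilG hG lG sG minT cf recf.
set T := mulX a; set Tinv := mulX (invX a).
set F := Defs.skew mulG T f; set Finv := skew_inv mulG invG Tinv f.
have TK : cancel T Tinv by move=> x; rewrite /T /Tinv !(tgE topX).
have TVK : cancel Tinv T by move=> x; rewrite /T /Tinv !(tgE topX).
have FK : cancel F Finv.
  by move=> [x g]; rewrite /F /Finv /Defs.skew /skew_inv /= TK !(tgE topG).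
have FVK : cancel Finv F.
  by move=> [x g]; rewrite /F /Finv /Defs.skew /skew_inv /= TVK !(tgE topG).
pose S := iter_z F Finv; pose b n := iter_z T Tinv n oneX.
have iterE n x : iter_z T Tinv n x = mulX (b n) x.
  rewrite /b; elim/int_ind: n => [|n IH|n IH]; first by rewrite /= !(tgE topX).
  - have -> : (n.+1%:Z = n%:Z + 1)%R by lia.
    by rewrite !(iter_zS TVK) IH /T !(tgE topX).
  - have -> : (- n.+1%:Z = -1 + (- n%:Z))%R by lia.
    by rewrite !(iter_zD TK TVK) IH /= /Tinv !(tgE topX).
have bD m n : b (m + n)%R = mulX (b m) (b n).
  by rewrite {1}/b (iter_zD TK TVK) iterE.
have Sfst n p : (S n p).1 = mulX (b n) p.1.
  by rewrite -iterE /S; case: n => n /=; elim: n => //= n ->.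
have Sact n p c : S n (ract mulG p c) = ract mulG (S n p) c.
  have FE q : F (ract mulG q c) = ract mulG (F q) c.
    by rewrite /F /Defs.skew /ract /= !(tgE topG).
  have FVE q : Finv (ract mulG q c) = ract mulG (Finv q) c.
    by rewrite /Finv /skew_inv /ract /= !(tgE topG).
  rewrite /S; case: n => n /=; first by elim: n => //= n ->.
  by elim: n => //= n ->.
have S_nat (k : nat) x : S k (x, oneG) = (iter k T x, cocycle_nat mulG oneG T f k x).
  by rewrite /S; elim: k => //= k ->.
have Scocycle n x : (S n (x, oneG)).2 = cocycle mulG invG oneG T Tinv f n x.
  case: n => k; first by rewrite S_nat.
  (* [Negz k] is [-(k+1)]: [k+1] steps forward from [x'] reach [x] with fibre coordinate [c], and
     undoing them shows that the backward value is [invG c]. *)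
  set x' := iter_z T Tinv (Negz k) x.
  have x'x : iter k.+1 T x' = x.
    by have := iter_zD TK TVK k.+1 (Negz k) x; rewrite (_ : _ + _ = 0)%R //; lia.
  have : S (Negz k) (S k.+1 (x', oneG)) = (x', oneG).
    by rewrite /S -(iter_zD FK FVK) (_ : _ + _ = 0)%R //; lia.
  rewrite S_nat x'x /cocycle -/x'; set c := cocycle_nat _ _ _ _ _ _.
  have -> : (x, c) = ract mulG (x, oneG) c by rewrite /ract /= !(tgE topG).
  rewrite Sact /ract => /(congr1 snd) /= Sc.
  by rewrite [in RHS](tg_inv_eq topG Sc) (tg_invK topG).
have Scont n : continuous (S n).
  have contF : continuous F.
    move=> [x g]; apply: cvg_pair;
      [apply: (tg_mul_cvg topX)|apply: (tg_mul_cvg topG)].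
    - exact: cvg_cst.
    - exact: cvg_fst.
    - by apply: cvg_comp; [exact: cvg_fst|exact: cf].
    - exact: cvg_snd.
  have contFV : continuous Finv.
    move=> [x g]; apply: cvg_pair;
      [apply: (tg_mul_cvg topX)|apply: (tg_mul_cvg topG)].
    - exact: cvg_cst.
    - exact: cvg_fst.
    - apply: (cvg_comp _ (fun x => invG (f (Tinv x)))); first exact: cvg_fst.
      apply: (cvg_comp (f \o Tinv) invG); last exact: (tg_inv_cont topG).
      by apply: cvg_comp; [exact: (tg_mull_cont topX)|exact: cf].
    - exact: cvg_snd.
  have iter_cont (h : X * G -> X * G) k : continuous h -> continuous (iter k h).
    move=> ch; elim: k => [|k IH] p; first exact: cvg_id.
    by apply: cvg_comp; [exact: IH|exact: ch].
  by case: n => k; apply: iter_cont.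
have hX := metrizable_hausdorff mX.
have lcX : small_compact_nbhs X.
  by move=> x A; apply: (compact_small_nbhs hX cX); exact: filterT.
have b_dense (x y : X) (O : set X) : nbhs y O -> exists n, O (mulX (b n) x).
  move=> nO; have : closure (orbit_z T Tinv x) y by rewrite minT.
  by move=> /(_ O nO)[_ [[n _ <-] On]]; exists n; rewrite -iterE.
have baseX : countable_base X.
  (* The dense sequence is the orbit of [oneX]; indices that code no integer default to [oneX]. *)
  apply: (@metrizable_countable_base _ mX
    (fun i => if unpickle i is Some n then b n else oneX)).
  move=> z A /(b_dense oneX)[n An]; exists (pickle n).
  by rewrite pickleK -(tg_mulr1 topX (b n)).
have S_rec (U : set G) (O : set X) (y : X) : nbhs oneG U -> nbhs y O ->
    exists n x, [/\ n <> 0%R, O x, O (mulX (b n) x) & U (S n (x, oneG)).2].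
  move=> nU nO.
  have [||||n [/eqP n0 [x [Obx Ox Un]]]] := recf U° O°.
  - exact: open_interior.
  - exact: nU.
  - exact: open_interior.
  - by exists y.
  exists n, x; split => //; [exact: interior_subset| |].
    by rewrite -iterE; exact: interior_subset.
  by rewrite Scocycle; exact: interior_subset.
have [p pP] := nilpotent_regular topG topX bD (S := S) (fun p => erefl) (iter_zD FK FVK)
  Scont Sfst Sact cX lX lcX (locally_compact_nbhs hG lG)
  (countable_base_prod baseX (second_countable_base sG)) b_dense S_rec nilG.
exists p; rewrite predeqE => x; split => // _; have [g gP] := pP x.
exists (x, g) => // A /gP[n An]; exists (S n p); split => //.
by exists n.
Qed.
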